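(* For all $n\ge2$, we have $c_n(132,213,312)=n+2$.
   Context: A word $\pi=\pi_1\dots\pi_m$ over the positive integers contains the pattern $\sigma=\sigma_1\dots\sigma_k$ if there are indices $1\le i_1<\dots<i_k\le m$ such that for all $r,s\in\{1,\dots,k\}$: $\pi_{i_r}<\pi_{i_s}$ iff $\sigma_r<\sigma_s$, and $\pi_{i_r}=\pi_{i_s}$ iff $\sigma_r=\sigma_s$; otherwise $\pi$ avoids $\sigma$. $\mathcal{C}_n$ denotes the set of nonnesting permutations: arrangements (words) of the multiset $\{1,1,2,2,\dots,n,n\}$ that avoid the patterns $1221$ and $2112$. For patterns $\sigma,\tau,\dots$, $c_n(\sigma,\tau,\dots)$ is the number of $\pi\in\mathcal{C}_n$ avoiding all of $\sigma,\tau,\dots$. *)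

(* Defs.v *)
From mathcomp Require Import all_boot.

Set Implicit Arguments.
Unset Strict Implicit.
Unset Printing Implicit Defensive.

(* Positions are 0-based: the letter pi_(i+1) of a word is [nth 0 pi i]. *)
Definition contains (pi sigma : seq nat) : bool :=
  [exists i : {ffun 'I_(size sigma) -> 'I_(size pi)},
     [forall r : 'I_(size sigma), forall s : 'I_(size sigma),
        (r < s) ==> (i r < i s)] &&
     [forall r : 'I_(size sigma), forall s : 'I_(size sigma),
        ((nth 0 pi (i r) < nth 0 pi (i s)) ==
           (nth 0 sigma r < nth 0 sigma s)) &&
        ((nth 0 pi (i r) == nth 0 pi (i s)) ==
           (nth 0 sigma r == nth 0 sigma s))]].

Definition avoids (pi sigma : seq nat) : bool := ~~ contains pi sigma.

(* The multiset {1,1,2,2,...,n,n}, as the word 1 1 2 2 ... n n. *)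
Definition double_word (n : nat) : seq nat :=
  flatten [seq [:: i; i] | i <- iota 1 n].

(* [permutations s] lists each distinct rearrangement of [s] exactly once, even
   when [s] has repeated letters, so this is a duplicate-free enumeration of
   C_n and sizes of its sublists are cardinalities. *)
Definition nonnesting (n : nat) : seq (seq nat) :=
  [seq pi <- permutations (double_word n)
     | avoids pi [:: 1; 2; 2; 1] && avoids pi [:: 2; 1; 1; 2]].

Definition c (n : nat) (patterns : seq (seq nat)) : nat :=
  size [seq pi <- nonnesting n | all (avoids pi) patterns].

(* Main.v *)
Require Import Defs.
From mathcomp Require Import all_boot zify.

Set Implicit Arguments.
Unset Strict Implicit.
Unset Printing Implicit Defensive.

(** Everything is decided by the least letter [a].  A larger letter [x] before a
    copy of [a] and a larger letter [y] after it form a 213 if [x < y] and a 312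
    if [y < x], so [x = y].  If there are at least two larger letters, no copy
    of [a] can therefore have larger letters on both sides: the two copies are
    both at the front, both at the back, or one at each end
    ([minimum_at_an_end]).  The last case is impossible, because the two copies
    of a larger letter would lie between them and form a 1221.

    - If the word is [a a r], avoiding 132 makes [r] weakly increasing, so the
      whole word is [a a b b c c ...], a single possibility.
    - If the word is [r a a], then [r] is any admissible word on the larger
      letters: each forbidden pattern either ends in a letter that is not its
      minimum, or is 1221, which also starts with its minimum; hence the new
      copies of [a] create no pattern ([admissible_cat2]).

    So every additional letter adds one word to the count.  With two letters,
    four of the six arrangements survive (1221 and 2112 are the other two), and
    the count for [n] letters is [4 + (n - 2) = n + 2].

    The induction removes the least letter, so it runs over an arbitrary
    strictly increasing list of letters rather than over 1, ..., n. *)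

(** * Pattern containment through subsequences *)

(** The quantifiers range over explicit lists of indices so that, for a concrete
    pattern, the condition reduces to finitely many comparisons of letters. *)
Definition order_isomorphic (v sigma : seq nat) : bool :=
  (size v == size sigma) &&
  all (fun r => all (fun s =>
      ((nth 0 v r < nth 0 v s) == (nth 0 sigma r < nth 0 sigma s)) &&
      ((nth 0 v r == nth 0 v s) == (nth 0 sigma r == nth 0 sigma s)))
    (iota 0 (size sigma))) (iota 0 (size sigma)).

Lemma subseq_nthP (T : eqType) (x0 : T) (v w : seq T) :
  reflect (exists js, [/\ sorted ltn js, all (gtn (size w)) js
                        & v = map (nth x0 w) js])
          (subseq v w).
Proof.
apply: (iffP idP) => [/subseqP [m sz_m ->]|[js [js_sorted js_lt ->]]].
  exists (mask m (iota 0 (size w))); split.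
  - by apply: sorted_mask (iota_ltn_sorted _ _); apply: ltn_trans.
  - by apply/allP => j /mem_mask; rewrite mem_iota.
  - by rewrite map_mask map_nth_iota0 // take_size.
have -> : js = filter (mem js) (iota 0 (size w)).
  apply: (irr_sorted_eq ltn_trans ltnn) => //.
    by apply: sorted_filter (iota_ltn_sorted _ _); apply: ltn_trans.
  move=> j; rewrite mem_filter mem_iota /=.
  by case js_j: (j \in js) => //=; rewrite add0n; have /= -> := allP js_lt _ js_j.
rewrite -[X in subseq _ X](take_size w) -(map_nth_iota0 x0 (leqnn _)).
exact/map_subseq/filter_subseq.
Qed.

(** Replacing an embedding of index types by a subsequence makes closure under
    subsequences and the splitting of an occurrence along a concatenation
    available. *)
Lemma containsP (w sigma : seq nat) :
  reflect (exists2 v, subseq v w & order_isomorphic v sigma)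
          (contains w sigma).
Proof.
apply: (iffP existsP) => [[i /andP [i_incr i_iso]]|[v]].
  pose js := [seq val (i r) | r <- enum 'I_(size sigma)].
  have sz_js : size js = size sigma by rewrite size_map size_enum_ord.
  have nth_js k (lt_k : k < size sigma) : nth 0 js k = i (Ordinal lt_k).
    rewrite (nth_map (Ordinal lt_k)) ?size_enum_ord //.
    by rewrite -[X in nth _ _ X]/(val (Ordinal lt_k)) nth_ord_enum.
  exists (map (nth 0 w) js).
    apply/(subseq_nthP 0); exists js; split=> //.
      rewrite sorted_pairwise; last exact: ltn_trans.
      apply/(pairwiseP 0) => j k; rewrite !inE sz_js => lt_j lt_k lt_jk.
      rewrite !nth_js; move/forallP/(_ (Ordinal lt_j)): i_incr.
      by move/forallP/(_ (Ordinal lt_k)); rewrite /= lt_jk.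
    by apply/allP => j /mapP [r _ ->]; rewrite /= ltn_ord.
  rewrite /order_isomorphic size_map sz_js eqxx /=.
  apply/allP => r; rewrite mem_iota /= => lt_r.
  apply/allP => s; rewrite mem_iota /= => lt_s.
  rewrite !(nth_map 0) ?sz_js // !nth_js.
  exact: (forallP (forallP i_iso (Ordinal lt_r)) (Ordinal lt_s)).
case/(subseq_nthP 0) => js [js_sorted js_lt ->].
rewrite /order_isomorphic size_map => /andP [/eqP sz_js /allP js_iso].
have lt_js (r : 'I_(size sigma)) : nth 0 js r < size w.
  by apply: (allP js_lt); rewrite mem_nth ?sz_js.
exists [ffun r => Ordinal (lt_js r)]; apply/andP; split.
  apply/forallP => r; apply/forallP => s; apply/implyP => lt_rs.
  rewrite !ffunE /=.
  by apply: (sorted_ltn_nth ltn_trans 0 js_sorted) => //; rewrite inE sz_js.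
apply/forallP => r; apply/forallP => s; rewrite !ffunE /=.
have /js_iso/allP/(_ (val s)) : val r \in iota 0 (size sigma).
  by rewrite mem_iota /=.
by rewrite mem_iota /= !(nth_map 0) ?sz_js //; apply.
Qed.

Definition admissible (w : seq nat) : bool :=
  all (avoids w) [:: [:: 1; 2; 2; 1]; [:: 2; 1; 1; 2];
                     [:: 1; 3; 2]; [:: 2; 1; 3]; [:: 3; 1; 2]].

Lemma admissibleP (w : seq nat) :
  reflect [/\ forall x y, x < y -> ~~ subseq [:: x; y; y; x] w,
              forall x y, x < y -> ~~ subseq [:: y; x; x; y] w
            & forall x y z, x < y -> y < z ->
                [/\ ~~ subseq [:: x; z; y] w, ~~ subseq [:: y; x; z] w
                  & ~~ subseq [:: z; x; y] w]]
          (admissible w).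
Proof.
have occ v sigma : order_isomorphic v sigma -> avoids w sigma ->
    ~~ subseq v w.
  by move=> iso; apply: contra => sub; apply/containsP; exists v.
apply: (iffP idP) => [/and5P [a1 a2 a3 a4 /andP[a5 _]]|[a1 a2 a3]].
  split=> [x y|x y|x y z].
  - by move=> lt_xy; apply: occ a1; rewrite /order_isomorphic /=; lia.
  - by move=> lt_xy; apply: occ a2; rewrite /order_isomorphic /=; lia.
  - move=> lt_xy lt_yz; split.
    + by apply: occ a3; rewrite /order_isomorphic /=; lia.
    + by apply: occ a4; rewrite /order_isomorphic /=; lia.
    + by apply: occ a5; rewrite /order_isomorphic /=; lia.
rewrite /admissible /= /avoids; apply/and5P; split; last (apply/andP; split=> //).
- apply/containsP => -[[|x [|y [|z [|t [|? ?]]]]] //= sub iso].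
  have [lt_xy [eq_yz eq_xt]] : x < y /\ y = z /\ x = t.
    by move: iso; rewrite /order_isomorphic /=; lia.
  by move: sub; rewrite -eq_yz -eq_xt (negbTE (a1 _ _ lt_xy)).
- apply/containsP => -[[|x [|y [|z [|t [|? ?]]]]] //= sub iso].
  have [lt_xy [eq_yz eq_xt]] : y < x /\ y = z /\ x = t.
    by move: iso; rewrite /order_isomorphic /=; lia.
  by move: sub; rewrite -eq_yz -eq_xt (negbTE (a2 _ _ lt_xy)).
- apply/containsP => -[[|x [|y [|z [|? ?]]]] //= sub iso].
  have [lt_xz lt_zy] : x < z /\ z < y.
    by move: iso; rewrite /order_isomorphic /=; lia.
  by have [/negP] := a3 _ _ _ lt_xz lt_zy.
- apply/containsP => -[[|x [|y [|z [|? ?]]]] //= sub iso].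
  have [lt_yx lt_xz] : y < x /\ x < z.
    by move: iso; rewrite /order_isomorphic /=; lia.
  by have [_ /negP] := a3 _ _ _ lt_yx lt_xz.
- apply/containsP => -[[|x [|y [|z [|? ?]]]] //= sub iso].
  have [lt_yz lt_zx] : y < z /\ z < x.
    by move: iso; rewrite /order_isomorphic /=; lia.
  by have [_ _ /negP] := a3 _ _ _ lt_yz lt_zx.
Qed.

Lemma admissible_subseq (v w : seq nat) :
  subseq v w -> admissible w -> admissible v.
Proof.
move=> sub; apply: sub_all => sigma; apply: contra => /containsP [u sub_u iso].
by apply/containsP; exists u => //; apply: subseq_trans sub.
Qed.

Lemma sorted_admissible (w : seq nat) : sorted leq w -> admissible w.
Proof.
move=> w_sorted; have sub v : subseq v w -> sorted leq v.
  by move/subseq_sorted; apply=> //; apply: leq_trans.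
apply/admissibleP; split=> [x y|x y|x y z] lt_xy.
- by apply/negP => /sub /=; lia.
- by apply/negP => /sub /=; lia.
- by move=> lt_yz; split; apply/negP => /sub /=; lia.
Qed.

(** * Appending two copies of a new minimum *)

Lemma subseq_rcons_cat2 (T : eqType) (u w : seq T) (a z : T) :
  subseq (rcons u z) (w ++ [:: a; a]) -> subseq (rcons u z) w \/ z = a.
Proof.
case: (eqVneq z a) => [|z_neq]; first by right.
rewrite -subseq_rev rev_cat rev_rcons /= !(negbTE z_neq) => sub; left.
by rewrite -subseq_rev rev_rcons.
Qed.

(** An occurrence that starts with a letter absent from the first factor lies
    entirely in the second one. *)
Lemma subseq_cons_cat (T : eqType) (u w t : seq T) (a : T) :
  a \notin w -> subseq (a :: u) (w ++ t) = subseq (a :: u) t.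
Proof.
elim: w => //= x w IHw; rewrite inE negb_or => /andP [/negbTE neq a_w].
by rewrite neq -IHw.
Qed.

(** An occurrence that uses the new copies of [a] ends in [a], which is then its
    least letter; but 132, 213, 312 and 2112 do not end in their minimum, and
    1221 starts with it as well, which forces the occurrence into [a a]. *)
Lemma admissible_cat2 (a : nat) (w : seq nat) :
  all (ltn a) w -> admissible (w ++ [:: a; a]) = admissible w.
Proof.
move=> lt_a_w; apply/idP/idP; first exact/admissible_subseq/prefix_subseq.
have a_w : a \notin w by apply/negP => /(allP lt_a_w) /=; rewrite ltnn.
have ge_a u x : subseq u (w ++ [:: a; a]) -> x \in u -> a <= x.
  move=> /mem_subseq sub /sub.
  rewrite mem_cat => /orP [/(allP lt_a_w) /ltnW //|].
  by rewrite !inE orbb => /eqP ->.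
have tail u z : subseq (rcons u z) (w ++ [:: a; a]) ->
    ~~ subseq (rcons u z) w -> all (leq z) u.
  move=> sub /negP nsub; have [//|->] := subseq_rcons_cat2 sub.
  by apply/allP => x u_x; apply: (ge_a _ x sub); rewrite mem_rcons inE u_x orbT.
case/admissibleP => a1 a2 a3; apply/admissibleP; split=> [x y|x y|x y z] lt_xy.
- apply/negP => sub; have [/=|eq_xa] := @subseq_rcons_cat2 _ [:: x; y; y] _ _ _ sub.
    exact/negP/a1.
  (* A 1221 that ends in the minimum also starts with it, and nothing larger
     than the minimum follows its first copy. *)
  move: sub; rewrite eq_xa subseq_cons_cat //= eqxx.
  by have /negbTE -> : y != a by lia.
- apply/negP => sub.
  by have := @tail [:: y; x; x] y sub (a2 _ _ lt_xy); rewrite /=; lia.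
- move=> lt_yz; have [b1 b2 b3] := a3 _ _ _ lt_xy lt_yz; split; apply/negP => sub.
  + by have := @tail [:: x; z] y sub b1; rewrite /=; lia.
  + by have := @tail [:: y; x] z sub b2; rewrite /=; lia.
  + by have := @tail [:: z; x] y sub b3; rewrite /=; lia.
Qed.

(** * Position of the minimum *)

(** Otherwise [x a y] would be a 213 or a 312. *)
Lemma all_equal_around_min (a x y : nat) (u v : seq nat) :
    admissible (u ++ a :: v) -> a < x -> a < y -> x \in u -> y \in v -> x = y.
Proof.
move=> adm lt_ax lt_ay u_x v_y.
have sub : subseq [:: x; a; y] (u ++ a :: v).
  rewrite -(cat1s x); apply: cat_subseq; first by rewrite sub1seq.
  by rewrite /= eqxx sub1seq.
have {adm} /admissibleP [_ _ a3] := adm.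
case: (ltngtP x y) => // [lt_xy|lt_yx].
  by have [_ /negP] := a3 _ _ _ lt_ax lt_xy.
by have [_ _ /negP] := a3 _ _ _ lt_ay lt_yx.
Qed.

Definition doubled (s : seq nat) : seq nat := flatten [seq [:: i; i] | i <- s].

Lemma doubled_cons (a : nat) (s : seq nat) :
  doubled (a :: s) = [:: a, a & doubled s].
Proof. by []. Qed.

Lemma mem_doubled (s : seq nat) : doubled s =i s.
Proof.
move=> x; elim: s => //= y s IHs.
by rewrite [doubled _]/= !inE IHs; case: eqP.
Qed.

Lemma sorted_doubled (s : seq nat) : sorted ltn s -> sorted leq (doubled s).
Proof.
elim: s => [|a [|b s] IHs] //=; first by rewrite leqnn.
by case/andP=> lt_ab s_sorted; rewrite leqnn ltnW //=; apply: IHs.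
Qed.

Lemma two_copies (T : eqType) (a : T) (w : seq T) :
  count_mem a w = 2 ->
  exists p q r, w = p ++ a :: q ++ a :: r /\ a \notin p ++ q ++ r.
Proof.
move=> cnt; have a_w : a \in w by rewrite -has_pred1 has_count cnt.
case/splitPr: a_w cnt => p v; rewrite count_cat /= eqxx => cnt.
have : 0 < count_mem a p + count_mem a v by lia.
rewrite addn_gt0 -!has_count !has_pred1 => /orP [] a_w.
  case/splitPr: a_w cnt => p1 p2; rewrite count_cat /= eqxx => cnt.
  exists p1, p2, v; split; first by rewrite -catA.
  by rewrite -has_pred1 has_count !count_cat; lia.
case/splitPr: a_w cnt => p1 p2; rewrite count_cat /= eqxx => cnt.
exists p, p1, p2; split=> //.
by rewrite -has_pred1 has_count !count_cat; lia.
Qed.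

(** Two distinct larger letters are what rules out a copy of [a] in the middle;
    with a single one, [a b a b] is admissible. Two copies of [b] are what
    rules out one [a] at each end. *)
Lemma minimum_at_an_end (a b c : nat) (w : seq nat) :
    admissible w -> count_mem a w = 2 -> all (leq a) w ->
    b != c -> a < b -> a < c -> 1 < count_mem b w -> c \in w ->
  exists r, w = [:: a, a & r] \/ w = r ++ [:: a; a].
Proof.
move=> adm cnt_a ge_a neq_bc lt_ab lt_ac cnt_b c_w.
have [p [q [r [w_eq]]]] := two_copies cnt_a.
rewrite !mem_cat !negb_or => /and3P [a_p a_q a_r].
have b_w : b \in w by rewrite -has_pred1 has_count; lia.
(* If both sides of a copy of the minimum contain larger letters, then all the
   larger letters of the word are equal, contradicting [b != c]. *)
have one_sided u v : w = u ++ a :: v ->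
    forall x y, x \in u -> y \in v -> a < x -> a < y -> False.
  move=> eq_w x y u_x v_y lt_ax lt_ay; rewrite eq_w in adm.
  have eq_xy := all_equal_around_min adm lt_ax lt_ay u_x v_y.
  have eq_x z : z \in w -> a < z -> z = x.
    rewrite eq_w mem_cat inE => /or3P [u_z|/eqP -> |v_z] lt_az.
    - by rewrite (all_equal_around_min adm lt_az lt_ay u_z v_y).
    - by rewrite ltnn in lt_az.
    - by rewrite (all_equal_around_min adm lt_ax lt_az u_x v_z).
  by rewrite (eq_x b) // (eq_x c) // eqxx in neq_bc.
have gt_a x : x \in w -> x != a -> a < x.
  by move=> w_x neq; rewrite ltn_neqAle eq_sym neq; apply: (allP ge_a).
have gt_p x : x \in p -> a < x.
  move=> p_x; apply: gt_a; first by rewrite w_eq mem_cat p_x.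
  by apply: contraNneq a_p => <-.
have gt_q x : x \in q -> a < x.
  move=> q_x; apply: gt_a; first by rewrite w_eq !(mem_cat, inE) q_x !orbT.
  by apply: contraNneq a_q => <-.
have gt_r x : x \in r -> a < x.
  move=> r_x; apply: gt_a; first by rewrite w_eq !(mem_cat, inE) r_x !orbT.
  by apply: contraNneq a_r => <-.
(* [one_sided] at the first and at the second copy of the minimum. *)
have split1 := one_sided p (q ++ a :: r) w_eq.
have split2 := one_sided (p ++ a :: q) r.
rewrite -catA -cat1s -catA in split2.
have {}split2 := split2 w_eq.
have nil_or (u : seq nat) : u = [::] \/ exists x, x \in u.
  by case: u => [|x u]; [left | right; exists x; rewrite inE eqxx].
have [p0|[x p_x]] := nil_or p; last first.
  have [q0|[y q_y]] := nil_or q; last first.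
    case: (split1 x y); rewrite ?mem_cat ?q_y //; auto.
  have [r0|[y r_y]] := nil_or r; last first.
    case: (split1 x y); rewrite ?(mem_cat, inE) ?r_y ?orbT //; auto.
  by exists p; right; rewrite w_eq q0 r0.
have [q0|[x q_x]] := nil_or q.
  by exists r; left; rewrite w_eq p0 q0.
have [r0|[y r_y]] := nil_or r; last first.
  case: (split2 x y); rewrite ?(mem_cat, inE) ?q_x ?orbT //; auto.
(* With the minimum at both ends, two copies of any other letter in between
   form a 1221. *)
have /admissibleP [/(_ a b lt_ab)/negP no_abba _ _] := adm.
case: no_abba.
have bb_q : subseq [:: b; b] q.
  have cnt : 1 < count_mem b q.
    move: cnt_b; rewrite w_eq p0 r0 /= count_cat /= [a == b](_ : _ = false); lia.
  have -> : [:: b; b] = take 2 (filter (pred1 b) q).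
    by rewrite (all_pred1P _ _ (filter_all _ _)) size_filter take_nseq //.
  by apply: subseq_trans (take_subseq _ _) (filter_subseq _ _).
rewrite w_eq p0 r0 /= eqxx -[[:: b; b; a]]/([:: b; b] ++ [:: a]).
exact: cat_subseq.
Qed.

(** A descent after [a] would complete it to a 132. *)
Lemma sorted_admissible_after_min (a : nat) (r : seq nat) :
  all (ltn a) r -> admissible (a :: r) -> sorted leq r.
Proof.
elim: r => [|x [|y r] IHr] // gt_a adm.
have /= /and3P [lt_ax lt_ay lt_ar] := gt_a.
have le_xy : x <= y.
  rewrite leqNgt; apply/negP => lt_yx.
  have /admissibleP [_ _ /(_ a y x lt_ay lt_yx) [/negP no_axy _ _]] := adm.
  by case: no_axy; rewrite /= !eqxx sub0seq.
rewrite /= le_xy; apply: IHr; first by rewrite /= lt_ay.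
apply: admissible_subseq adm.
by rewrite -(cat1s x) -(cat1s a) -(cat1s a (_ ++ _)) subseq_cat2l suffix_subseq.
Qed.

(** * The admissible words *)

(** The two-letter words are a genuine base case: there the minimum may alternate
    with the other letter. The value on the empty list is a filler that makes
    a one-letter list give its only word. *)
Fixpoint admissible_words (s : seq nat) : seq (seq nat) :=
  match s with
  | [::] => [::]
  | [:: a; b] =>
      [:: [:: a; a; b; b]; [:: a; b; a; b]; [:: b; a; b; a]; [:: b; b; a; a]]
  | a :: s' => doubled s :: [seq w ++ [:: a; a] | w <- admissible_words s']
  end.

Lemma admissible_words2 (a b : nat) (w : seq nat) : a < b ->
  (w \in admissible_words [:: a; b]) =
    perm_eq w (doubled [:: a; b]) && admissible w.
Proof.
move=> lt_ab; have neq_ab : (a == b) = false by lia.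
have neq_ba : (b == a) = false by lia.
apply/idP/andP => [|[perm_w /admissibleP [a1 a2 _]]].
  (* Patterns with three distinct letters cannot occur; an occurrence of a
     four-letter pattern is the whole word. *)
  have two_letters v : size v = 4 -> all (mem [:: a; b]) v ->
      v != [:: a; b; b; a] -> v != [:: b; a; a; b] -> admissible v.
    move=> sz_v /allP v_ab neq1 neq2.
    have in_ab u x : subseq u v -> x \in u -> x = a \/ x = b.
      by move=> /mem_subseq sub /sub /v_ab; rewrite !inE => /orP [] /eqP; auto.
    have eq_v u : subseq u v -> size u = 4 -> u = v.
      by move=> sub sz_u; apply/eqP; rewrite -(size_subseq_leqif sub) sz_u sz_v.
    apply/admissibleP; split=> [x y|x y|x y z] lt_xy.
    - apply/negP => sub.
      have := in_ab _ x sub; have := in_ab _ y sub; rewrite !inE !eqxx !orbT.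
      move=> /(_ isT) y_ab /(_ isT) x_ab; have [eq_x eq_y]: x = a /\ y = b by lia.
      by move: (eq_v _ sub erefl) neq1; rewrite eq_x eq_y => <-; rewrite eqxx.
    - apply/negP => sub.
      have := in_ab _ x sub; have := in_ab _ y sub; rewrite !inE !eqxx !orbT.
      move=> /(_ isT) y_ab /(_ isT) x_ab; have [eq_x eq_y]: x = a /\ y = b by lia.
      by move: (eq_v _ sub erefl) neq2; rewrite eq_x eq_y => <-; rewrite eqxx.
    - have three u : x \in u -> y \in u -> z \in u -> y < z -> ~~ subseq u v.
        move=> u_x u_y u_z lt_yz; apply/negP => sub.
        have := in_ab _ _ sub u_x; have := in_ab _ _ sub u_y.
        by have := in_ab _ _ sub u_z; lia.
      by move=> lt_yz; split; apply: three; rewrite // !inE eqxx ?orbT.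
  rewrite !inE => /or4P [] /eqP ->; (split; last by apply: two_letters;
    rewrite //= ?inE ?eqseq_cons ?neq_ab ?neq_ba ?eqxx ?andbF ?orbT);
  by apply/permP => P /=; lia.
have w_ab x : x \in w -> (x == a) || (x == b).
  by rewrite (perm_mem perm_w) mem_doubled !inE.
have := perm_size perm_w.
have /permP/(_ (pred1 a)) := perm_w; rewrite /= eqxx neq_ba /=.
case: w perm_w w_ab a1 a2 => [|x [|y [|z [|t [|? ?]]]]] // _ w_ab a1 a2 cnt _.
have := w_ab x; have := w_ab y; have := w_ab z; have := w_ab t.
rewrite !inE !eqxx !orbT => /(_ isT) t_ab /(_ isT) z_ab /(_ isT) y_ab /(_ isT) x_ab.
move: cnt (a1 a b lt_ab) (a2 a b lt_ab).
case/orP: t_ab => /eqP ->; case/orP: z_ab => /eqP ->;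
  case/orP: y_ab => /eqP ->; case/orP: x_ab => /eqP ->;
  by rewrite /= ?eqseq_cons ?eqxx ?neq_ab ?neq_ba ?eqxx ?orbT.
Qed.

Lemma mem_admissible_words (s w : seq nat) : sorted ltn s -> 1 < size s ->
  (w \in admissible_words s) = perm_eq w (doubled s) && admissible w.
Proof.
elim: s w => [//|a [//|b [|c s]] IHs] w s_sorted _.
  by move: s_sorted; rewrite /= andbT => lt_ab; apply: admissible_words2.
rewrite -[admissible_words _]/(doubled [:: a, b, c & s] ::
  [seq u ++ [:: a; a] | u <- admissible_words [:: b, c & s]]).
have [gt_a s'_sorted] : all (ltn a) [:: b, c & s] /\ sorted ltn [:: b, c & s].
  by apply/andP; rewrite -(path_sortedE (leT := ltn)) //; apply: ltn_trans.
have {}IHs u := IHs u s'_sorted isT.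
have gt_a' u : perm_eq u (doubled [:: b, c & s]) -> all (ltn a) u.
  move=> perm_u; apply/allP => x; rewrite (perm_mem perm_u) mem_doubled.
  exact: (allP gt_a).
rewrite inE; apply/orP/andP => [[/eqP ->|/mapP [u]]|[perm_w adm]].
- by split; last exact/sorted_admissible/sorted_doubled.
- rewrite IHs => /andP [perm_u adm] ->; rewrite admissible_cat2 ?gt_a' //.
  split=> //; rewrite perm_catC doubled_cons /=.
  by rewrite !perm_cons.
have [lt_ab lt_bc] : a < b /\ b < c by move: s_sorted => /= /and3P [].
(* The next two letters [b] and [c] serve as the two distinct larger letters. *)
have [] := @minimum_at_an_end a b c w adm.
- rewrite (permP perm_w) -[LHS]/((a == a) + ((a == a) +
    count_mem a (doubled [:: b, c & s]))) eqxx.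
  have /count_memPn -> // : a \notin doubled [:: b, c & s].
  by rewrite mem_doubled; apply/negP => /(allP gt_a); rewrite /= ltnn.
- apply/allP => x; rewrite (perm_mem perm_w) mem_doubled inE.
  by case/predU1P => [->|/(allP gt_a) /ltnW].
- by lia.
- by [].
- by lia.
- by rewrite (permP perm_w) !doubled_cons /= eqxx; lia.
- by rewrite (perm_mem perm_w) mem_doubled !inE eqxx !orbT.
move=> r [w_eq|w_eq].
  left; rewrite w_eq in perm_w adm *.
  have perm_r : perm_eq r (doubled [:: b, c & s]).
    by move: perm_w; rewrite doubled_cons !perm_cons.
  rewrite doubled_cons; apply/eqP; congr [:: _, _ & _].
  apply: (sorted_eq leq_trans anti_leq _ _ perm_r).
    apply: (sorted_admissible_after_min (gt_a' _ perm_r)).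
    exact/admissible_subseq/adm/subseq_cons.
  exact: sorted_doubled.
right; have perm_r : perm_eq r (doubled [:: b, c & s]).
  by move: perm_w; rewrite w_eq perm_catC doubled_cons /= !perm_cons.
apply/mapP; exists r => //; rewrite IHs perm_r.
by rewrite -(admissible_cat2 (gt_a' _ perm_r)) -w_eq.
Qed.

Lemma size_admissible_words (s : seq nat) :
  1 < size s -> size (admissible_words s) = size s + 2.
Proof.
elim: s => [//|a [//|b [//|c s]] IHs] _.
by rewrite -[LHS]/(size (map _ _)).+1 size_map IHs.
Qed.

Lemma admissible_words_uniq (s : seq nat) :
  sorted ltn s -> 1 < size s -> uniq (admissible_words s).
Proof.
elim: s => [//|a [//|b [|c s]] IHs] s_sorted _.
  have lt_ab : a < b by move: s_sorted; rewrite /= andbT.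
  have [neq_ab neq_ba] : (a == b) = false /\ (b == a) = false by lia.
  by rewrite /= !inE !eqseq_cons !eqxx neq_ab neq_ba.
have [gt_a s'_sorted] : all (ltn a) [:: b, c & s] /\ sorted ltn [:: b, c & s].
  by apply/andP; rewrite -(path_sortedE (leT := ltn)) //; apply: ltn_trans.
rewrite -[admissible_words _]/(doubled [:: a, b, c & s] ::
  [seq u ++ [:: a; a] | u <- admissible_words [:: b, c & s]]).
rewrite cons_uniq map_inj_uniq ?IHs ?andbT //; last first.
  by move=> u v; rewrite -!cat_rcons !cats0 => eq_uv; do 2!apply: (@rcons_injl _ a).
(* The increasing word starts with [a], the others with a larger letter. *)
apply/mapP => -[u]; rewrite mem_admissible_words // => /andP [perm_u _].
case: u perm_u => [/perm_size //|x u] perm_u [eq_xa _].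
have : x \in [:: b, c & s] by rewrite -mem_doubled -(perm_mem perm_u) mem_head.
by move/(allP gt_a); rewrite /= eq_xa ltnn.
Qed.

(** * The count *)

Theorem theorem2p13 (n : nat) (hn : 2 <= n) :
  c n [:: [:: 1; 3; 2]; [:: 2; 1; 3]; [:: 3; 1; 2]] = n + 2.
Proof.
have iota_sorted := iota_ltn_sorted 1 n.
have sz_iota := size_iota 1 n.
rewrite /c /nonnesting -filter_predI -[in RHS]sz_iota.
rewrite -size_admissible_words ?sz_iota //.
apply/perm_size/uniq_perm.
- exact/filter_uniq/permutations_uniq.
- by apply: admissible_words_uniq; rewrite ?sz_iota.
move=> w; rewrite mem_admissible_words ?sz_iota // mem_filter mem_permutations.
rewrite [RHS]andbC; congr (_ && _) => /=.
by rewrite andbC -andbA.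
Qed.
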